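(* Let $\mathscr{F}_1=\{A\subseteq\omega: |A|\leqslant 1\}$. Then the map $\mathfrak{f}\colon\boldsymbol{B}_{\mathbb{Z}}^{\mathscr{F}_1}\to\mathscr{B}_{\mathbb{Z}}(\omega_{\min})$ defined by $\mathfrak{f}(i,j,\{k\})=(i+k,k,j+k)$ for $i,j\in\mathbb{Z}$, $k\in\omega$, and $\mathfrak{f}(\boldsymbol{0})=\mathscr{O}$, is an isomorphism of semigroups; in particular $\boldsymbol{B}_{\mathbb{Z}}^{\mathscr{F}_1}$ is isomorphic to $\mathscr{B}_{\mathbb{Z}}(\omega_{\min})$.
   Context: $\omega$ is the set of non-negative integers. For $n\in\mathbb{Z}$ and $A\subseteq\mathbb{Z}$ put $n+A=\{n+a: a\in A\}$ (so $n+\varnothing=\varnothing$). A family $\mathscr{F}$ of subsets of $\omega$ is $\omega$-closed if $F_1\cap(-n+F_2)\in\mathscr{F}$ for all $n\in\omega$ and $F_1,F_2\in\mathscr{F}$; the family $\mathscr{F}_1$ is $\omega$-closed. For an $\omega$-closed family $\mathscr{F}$, the set $\mathbb{Z}\times\mathbb{Z}\times\mathscr{F}$ carries the associative operation $$(i_1,j_1,F_1)\cdot(i_2,j_2,F_2)=\begin{cases}(i_1-j_1+i_2,\;j_2,\;(j_1-i_2+F_1)\cap F_2), & j_1<i_2;\\ (i_1,\;j_2,\;F_1\cap F_2), & j_1=i_2;\\ (i_1,\;j_1-i_2+j_2,\;F_1\cap(i_2-j_1+F_2)), & j_1>i_2.\end{cases}$$ When $\varnothing\in\mathscr{F}$ (as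 for $\mathscr{F}_1$), $\boldsymbol{I}=\{(i,j,\varnothing): i,j\in\mathbb{Z}\}$ is an ideal and $\boldsymbol{B}_{\mathbb{Z}}^{\mathscr{F}}$ is defined as the Rees quotient $(\mathbb{Z}\times\mathbb{Z}\times\mathscr{F},\cdot)/\boldsymbol{I}$, in which $\boldsymbol{I}$ is collapsed to one element, the zero $\boldsymbol{0}$. Thus the nonzero elements of $\boldsymbol{B}_{\mathbb{Z}}^{\mathscr{F}_1}$ are the triples $(i,j,\{k\})$ with $i,j\in\mathbb{Z}$, $k\in\omega$. $\omega_{\min}$ is the semilattice $\omega$ with operation $xy=\min\{x,y\}$. For a semigroup $S$ and a nonempty set $X$, $\mathscr{B}_X(S)=(X\times S\times X)\sqcup\{\mathscr{O}\}$ is the semigroup (Brandt extension of $S$) with $(\alpha,s,\beta)\cdot(\gamma,t,\delta)=(\alpha,st,\delta)$ if $\beta=\gamma$ and $=\mathscr{O}$ if $\beta\neq\gamma$, and $(\alpha,s,\beta)\cdot\mathscr{O}=\mathscr{O}\cdot(\alpha,s,\beta)=\mathscr{O}\cdot\mathscr{O}=\mathscr{O}$, for all $\alpha,\beta,\gamma,\delta\in X$, $s,t\in S$. *)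

(* Defs.v *)
(* Mathematical Components, with the classical sets of MathComp-Analysis. *)
From HB Require Import structures.
From mathcomp Require Import all_boot all_order all_algebra.
From mathcomp Require Import zify.
From mathcomp Require Import boolp classical_sets functions cardinality.

Set Implicit Arguments.
Unset Strict Implicit.
Unset Printing Implicit Defensive.

Import Order.TTheory GRing.Theory Num.Theory.

Local Open Scope classical_set_scope.
Local Open Scope ring_scope.
Local Open Scope card_scope.
Local Open Scope quotient_scope.

Definition semigroup_isomorphism (S T : semigroupType) (f : S -> T) : Prop :=
  {morph f : x y / (x * y)%g} /\ bijective f.

Definition isomorphic (S T : semigroupType) : Prop :=
  exists f : S -> T, semigroup_isomorphism f.

(* Subsets of the non-negative integers are encoded as subsets of int that are
   contained in omega, so that they can be shifted by arbitrary integers. *)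

Definition omega : set int := range Posz.

Definition shift (n : int) (A : set int) : set int := [set n + a | a in A].

Definition omega_closed (F : set (set int)) : Prop :=
  forall (n : nat) (F1 F2 : set int),
    F F1 -> F F2 -> F (F1 `&` shift (- n%:Z) F2).

Record omega_closed_family := OmegaClosedFamily {
  family_set :> set (set int);
  family_sub_omega : forall A, family_set A -> A `<=` omega;
  family_omega_closed : omega_closed family_set }.

Definition family_elt (F : omega_closed_family) (A : set int) (FA : family_set F A) :
  set_type F := exist (fun B => B \in family_set F) A (mem_set FA).

(* The operation on Z x Z x F, with the sets in F seen as plain sets. *)
Definition bz_op (x y : int * int * set int) : int * int * set int :=
  let: (i1, j1, F1) := x in
  let: (i2, j2, F2) := y in
  if j1 < i2 then (i1 - j1 + i2, j2, shift (j1 - i2) F1 `&` F2)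
  else if j1 == i2 then (i1, j2, F1 `&` F2)
  else (i1, j1 - i2 + j2, F1 `&` shift (i2 - j1) F2).

Lemma shiftE n A z : shift n A z = A (z - n).
Proof.
apply/propext; split=> [[a Aa <-]|Az]; first by rewrite addrC addKr.
by exists (z - n) => //; rewrite addrC subrK.
Qed.

Lemma bz_opA : associative bz_op.
Proof.
move=> [[i1 j1] A] [[i2 j2] B] [[i3 j3] C]; rewrite /bz_op.
have tri (a b a' b' : int) (X Y : set int) :
    a = a' -> b = b' -> (forall z, X z = Y z) -> (a, b, X) = (a', b', Y).
  by move=> -> -> XY; congr (_, _, _); apply/funext.
repeat (case: ltgtP => ? //=); try lia; apply: tri; try lia;
  move=> z; rewrite /setI /= ?shiftE /= ?shiftE andA;
  congr ((A _ /\ B _) /\ C _); lia.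
Qed.

Section BZ0.

Variable F : omega_closed_family.

Definition bz0 : Type := (int * int * set_type F)%type.

HB.instance Definition _ := Choice.on bz0.

Definition bz0_raw (x : bz0) : int * int * set int := (x.1, \val x.2).

Lemma bz_op_closed (x y : bz0) :
  family_set F (bz_op (bz0_raw x) (bz0_raw y)).2.
Proof.
case: x y => [[i1 j1] [A FA]] [[i2 j2] [B FB]].
move: (set_mem FA) (set_mem FB) => FA' FB'.
rewrite /bz_op /=; case: ltgtP => [lt|lt|_] /=.
- rewrite setIC; have -> : j1 - i2 = - `|i2 - j1|%N%:Z by lia.
  exact: family_omega_closed.
- have -> : i2 - j1 = - `|j1 - i2|%N%:Z by lia.
  exact: family_omega_closed.
- have -> : B = shift (- 0%N%:Z) B.
    by apply/funext => z; rewrite shiftE oppr0 subr0.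
  exact: family_omega_closed.
Qed.

Definition bz0_mul (x y : bz0) : bz0 :=
  ((bz_op (bz0_raw x) (bz0_raw y)).1, family_elt (bz_op_closed x y)).

Lemma bz0_raw_mul x y : bz0_raw (bz0_mul x y) = bz_op (bz0_raw x) (bz0_raw y).
Proof. by rewrite {1}/bz0_raw /= -surjective_pairing. Qed.

Lemma bz0_raw_inj : injective bz0_raw.
Proof. by move=> [x A] [y B] [-> /val_inj ->]. Qed.

Lemma bz0_mulA : associative bz0_mul.
Proof. by move=> x y z; apply: bz0_raw_inj; rewrite !bz0_raw_mul bz_opA. Qed.

HB.instance Definition _ := isSemigroup.Build bz0 bz0_mulA.

End BZ0.

Record ideal (S : semigroupType) := Ideal {
  ideal_set :> set S;
  ideal_neq0 : ideal_set !=set0;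
  idealMl : forall x y, ideal_set y -> ideal_set (x * y)%g;
  idealMr : forall x y, ideal_set x -> ideal_set (x * y)%g }.

Section ReesQuotient.

Variables (S : semigroupType) (I : ideal S).

(* The congruence collapsing I to a point; by rees_mul_pi the operation on
   classes does not depend on the representatives picked by lift_op2. *)
Definition rees_rel (x y : S) : bool := `[< x = y \/ ideal_set I x /\ ideal_set I y >].

Lemma rees_rel_refl : reflexive rees_rel.
Proof. by move=> x; apply/asboolP; left. Qed.

Lemma rees_rel_sym : symmetric rees_rel.
Proof. by move=> x y; apply/asbool_equiv_eq; split=> -[->|[]]; tauto. Qed.

Lemma rees_rel_trans : transitive rees_rel.
Proof.
move=> y x z /asboolP[->|[Ix Iy]] // /asboolP[<-|[_ Iz]]; apply/asboolP; tauto.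
Qed.

Canonical rees_equiv := EquivRel rees_rel rees_rel_refl rees_rel_sym rees_rel_trans.

Definition rees_quotient : Type := {eq_quot rees_equiv}.

HB.instance Definition _ := Choice.on rees_quotient.
HB.instance Definition _ := EqQuotient.on rees_quotient.

Definition rees_mul : rees_quotient -> rees_quotient -> rees_quotient :=
  lift_op2 rees_quotient (fun x y : S => (x * y)%g).

Lemma rees_mul_pi (x y : S) :
  rees_mul (\pi_rees_quotient x) (\pi_rees_quotient y) =
  \pi_rees_quotient (x * y)%g.
Proof.
rewrite /rees_mul; unlock; apply/eqmodP/asboolP.
have /eqmodP/asboolP[->|[Ix Ix']] := reprK (\pi_rees_quotient x);
  have /eqmodP/asboolP[->|[Iy Iy']] := reprK (\pi_rees_quotient y).
- by left.
- by right; split; apply: idealMl.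
- by right; split; apply: idealMr.
- by right; split; apply: idealMr.
Qed.

Lemma rees_mulA : associative rees_mul.
Proof.
by move=> x y z; rewrite -[x]reprK -[y]reprK -[z]reprK !rees_mul_pi mulgA.
Qed.

HB.instance Definition _ := isSemigroup.Build rees_quotient rees_mulA.

Definition rees_zero : rees_quotient :=
  \pi_rees_quotient (projT1 (cid (ideal_neq0 I))).

Lemma rees_zeroE (x : S) : ideal_set I x -> \pi_rees_quotient x = rees_zero.
Proof.
move=> Ix; apply/eqmodP/asboolP; right; split=> //.
exact: (projT2 (cid (ideal_neq0 I))).
Qed.

End ReesQuotient.

Section BZ.

Variables (F : omega_closed_family) (F0 : family_set F set0).

Definition bz_ideal_set : set (bz0 F) := [set x | \val x.2 = set0].

Lemma bz_ideal_neq0 : bz_ideal_set !=set0.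
Proof. by exists (0, 0, family_elt F0). Qed.

Lemma shift0 n : shift n set0 = set0.
Proof. exact: image_set0. Qed.

Lemma bz_idealMl x y : bz_ideal_set y -> bz_ideal_set (x * y)%g.
Proof.
move: x y => [[i1 j1] A] [[i2 j2] B]; rewrite /bz_ideal_set /= => ->.
by case: ltgtP => _ /=; rewrite ?shift0 setI0.
Qed.

Lemma bz_idealMr x y : bz_ideal_set x -> bz_ideal_set (x * y)%g.
Proof.
move: x y => [[i1 j1] A] [[i2 j2] B]; rewrite /bz_ideal_set /= => ->.
by case: ltgtP => _ /=; rewrite ?shift0 set0I.
Qed.

Definition bz_ideal : ideal (bz0 F) := Ideal bz_ideal_neq0 bz_idealMl bz_idealMr.

Definition bz : semigroupType := rees_quotient bz_ideal.

Definition bz_zero : bz := rees_zero bz_ideal.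

Definition bz_class (x : bz0 F) : bz := \pi_(rees_quotient bz_ideal) x.

End BZ.

(* `I_1 is the one-element set {0}, so the second condition is |A| <= 1. *)
Definition F1_set : set (set int) := [set A | A `<=` omega /\ A #<= `I_1].

Lemma F1_sub_omega A : F1_set A -> A `<=` omega.
Proof. by case. Qed.

Lemma F1_omega_closed : omega_closed F1_set.
Proof.
move=> n A B [Aw A1] _; split; first by move=> z [/Aw].
exact: card_le_trans (subset_card_le (@subIsetl _ _ _)) A1.
Qed.

Definition F1 : omega_closed_family :=
  OmegaClosedFamily F1_sub_omega F1_omega_closed.

Lemma F1_set0 : family_set F1 set0.
Proof. by split; [exact: sub0set|exact: card_ge0]. Qed.

Lemma F1_singleton (k : nat) : family_set F1 [set k%:Z].
Proof.
split; first by move=> _ ->; exists k.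
by rewrite (card_le_eql card_set1) card_lexx.
Qed.

Definition bz_F1 : semigroupType := bz F1_set0.

Definition bz_F1_elt (i j : int) (k : nat) : bz_F1 :=
  bz_class F1_set0 (i, j, family_elt (F1_singleton k)).

Definition omega_min : Type := nat.

HB.instance Definition _ := Choice.on omega_min.
HB.instance Definition _ := isSemigroup.Build omega_min minnA.

Section Brandt.

Variables (X : choiceType) (S : semigroupType).

(* X is arbitrary here; None is the zero adjoined to X x S x X. *)
Definition brandt : Type := option (X * S * X).

HB.instance Definition _ := Choice.on brandt.

Definition brandt_mul (x y : brandt) : brandt :=
  match x, y with
  | Some (a, s, b), Some (c, t, d) =>
      if b == c then Some (a, (s * t)%g, d) else None
  | _, _ => None
  end.

Lemma brandt_mulA : associative brandt_mul.
Proof.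
move=> [[[a s] b]|] [[[c t] d]|] [[[e u] f]|] //=; repeat case: eqP => //=.
by move=> *; rewrite mulgA.
Qed.

HB.instance Definition _ := isSemigroup.Build brandt brandt_mulA.

Definition brandt_zero : brandt := None.

Definition brandt_elt (a : X) (s : S) (b : X) : brandt := Some (a, s, b).

End Brandt.

(* Main.v *)
(* Shifting a singleton gives a singleton, so the product of (i, j, {k}) and
   (i', j', {l}) is nonzero exactly when j + k = i' + l, and it is then the
   triple (i + k - m, j' + l - m, {m}) with m = min(k, l). In the coordinates
   (i + k, k, j + k) this is the multiplication of the Brandt extension. It is
   the inverse map (a, k, b) |-> (a - k, b - k, {k}) that is studied, since it
   is given without a choice of representatives in the Rees quotient. *)
Require Import Defs.
From HB Require Import structures.
From mathcomp Require Import all_boot all_order all_algebra.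
From mathcomp Require Import zify.
From mathcomp Require Import boolp classical_sets functions cardinality.

Set Implicit Arguments.
Unset Strict Implicit.
Unset Printing Implicit Defensive.

Import Order.TTheory GRing.Theory Num.Theory.
Local Open Scope ring_scope.

(** An injection of [A] into [I_1] takes only the value 0, so any two elements of [A] coincide. *)
Lemma card_le_I1 (T : Type) (A : set T) :
  card_le A `I_1 -> A = set0 \/ exists x, A = [set x]%classic.
Proof.
move=> /pcard_leP[f]; have [->|/set0P[x Ax]] := eqVneq A set0; [by left|right].
have f0 y : A y -> f y = 0%N.
  by move=> /(@funS _ _ _ _ f) /=; rewrite ltnS leqn0 => /eqP.
exists x; apply/seteqP; split=> [y Ay|_ -> //].
apply: (@inj _ _ _ f); [exact: mem_set|exact: mem_set|].
exact: etrans (f0 y Ay) (esym (f0 x Ax)).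
Qed.

Lemma set1_inj (T : Type) : injective (@set1 T).
Proof. by move=> x y /seteqP[+ _] => /(_ x); apply. Qed.

Lemma set1_neq0 (T : Type) (x : T) : [set x]%classic <> set0.
Proof. by move=> /seteqP[/(_ x)+ _]; apply. Qed.

Section BZ.

Variables (F : omega_closed_family) (F0 : family_set F set0).

Lemma bz_class_eq (x y : bz0 F) :
  bz_class F0 x = bz_class F0 y <->
  x = y \/ \val x.2 = set0 /\ \val y.2 = set0.
Proof.
by split=> [/eqmodP/asboolP|H]; last apply/eqmodP/asboolP.
Qed.

Lemma bz_class_zero (x : bz0 F) :
  bz_class F0 x = bz_zero F0 <-> \val x.2 = set0.
Proof.
(* The zero is the class of a chosen element of the ideal; any explicit triple with empty set
   represents it equally well. *)
have E0 : bz_zero F0 = bz_class F0 (0, 0, family_elt F0).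
  exact/esym/rees_zeroE.
by rewrite E0 bz_class_eq; split=> [[->|[]]|] //; right.
Qed.

Lemma bz_classM (x y : bz0 F) :
  (bz_class F0 x * bz_class F0 y)%g = bz_class F0 (x * y)%g.
Proof. exact: rees_mul_pi. Qed.

Lemma bz_class_surj (x : bz F0) : exists y, x = bz_class F0 y.
Proof. by exists (repr x); rewrite /bz_class reprK. Qed.

Lemma bz_mul0 (x : bz F0) : (bz_zero F0 * x)%g = bz_zero F0.
Proof.
have [y ->] := bz_class_surj x; have [z Ez] := bz_class_surj (bz_zero F0).
(* The representative [z] lies in the ideal because its class is the zero, and the ideal absorbs
   products. *)
rewrite Ez bz_classM -Ez bz_class_zero; apply: bz_idealMr.
exact/bz_class_zero.
Qed.

Lemma bz_mulr0 (x : bz F0) : (x * bz_zero F0)%g = bz_zero F0.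
Proof.
have [y ->] := bz_class_surj x; have [z Ez] := bz_class_surj (bz_zero F0).
rewrite Ez bz_classM -Ez bz_class_zero; apply: bz_idealMl.
exact/bz_class_zero.
Qed.

End BZ.

Lemma shift_set1 (n k : int) : shift n [set k]%classic = [set n + k]%classic.
Proof. exact: image_set1. Qed.

Lemma set1I (T : choiceType) (x y : T) :
  ([set x] `&` [set y])%classic = if x == y then [set y]%classic else set0.
Proof.
case: eqP => [->|xy]; first exact: setIid.
by apply/seteqP; split=> // z [-> /= /xy].
Qed.

Lemma bz_F1_eltM (i j i' j' : int) (k l : nat) :
  (bz_F1_elt i j k * bz_F1_elt i' j' l)%g =
  if j + k%:Z == i' + l%:Z then
    bz_F1_elt (i + k%:Z - (minn k l)%:Z) (j' + l%:Z - (minn k l)%:Z) (minn k l)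
  else bz_zero F1_set0.
Proof.
rewrite /bz_F1_elt bz_classM; case: eqP => jk; last first.
  rewrite bz_class_zero /=.
  by case: ltgtP => ij /=; rewrite ?shift_set1 set1I ifN_eq //; lia.
apply/bz_class_eq; left; apply: bz0_raw_inj; rewrite bz0_raw_mul /bz0_raw /=.
(* Since j + k = i' + l, one has j < i' exactly when l < k, so the three branches of the operation
   are the three cases of [minn k l]. *)
case: ltgtP => ij /=; rewrite ?shift_set1 set1I ifT; try lia;
  congr (_, _, [set _]%classic); lia.
Qed.

Lemma bz_F1_cases (x : bz_F1) :
  x = bz_zero F1_set0 \/ exists i j k, x = bz_F1_elt i j k.
Proof.
have [[[i j] A] ->] := bz_class_surj x; have [Aw /card_le_I1] := set_mem (valP A).
case=> [A0|[a Aa]]; [by left; apply/bz_class_zero|right].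
have [k _ ka] : omega a by apply: Aw; rewrite Aa.
exists i, j, k; apply/bz_class_eq; left; congr (_, _, _).
by apply/val_inj; rewrite /= Aa ka.
Qed.

Definition of_brandt (x : brandt int omega_min) : bz_F1 :=
  if x is Some (a, k, b) then bz_F1_elt (a - Posz k) (b - Posz k) k
  else bz_zero F1_set0.

Lemma bz_F1_elt_neq0 (i j : int) (k : nat) : bz_F1_elt i j k <> bz_zero F1_set0.
Proof. by move/bz_class_zero; apply: set1_neq0. Qed.

Lemma of_brandt_inj : injective of_brandt.
Proof.
move=> [[[a s] b]|] [[[c t] d]|] //=.
- move=> /bz_class_eq[/(congr1 (@bz0_raw F1))|[s0 _]]; last by case: (set1_neq0 s0).
  (* The singletons give [s = t] first; then the common shift cancels in the two integer
     coordinates. *)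
  rewrite /bz0_raw => -[ac bd E]; have [st] := set1_inj E.
  by move: ac bd; rewrite st => /addIr -> /addIr ->.
- by move/bz_F1_elt_neq0.
- by move/esym/bz_F1_elt_neq0.
Qed.

Lemma of_brandt_elt (i j : int) (k : nat) :
  of_brandt (brandt_elt (i + k%:Z) (k : omega_min) (j + k%:Z)) = bz_F1_elt i j k.
Proof. by rewrite /= !addrK. Qed.

Lemma of_brandt_surj (x : bz_F1) : exists y, of_brandt y = x.
Proof.
have [->|[i [j [k ->]]]] := bz_F1_cases x; first by exists None.
by eexists; apply: of_brandt_elt.
Qed.

Lemma of_brandtM : {morph of_brandt : x y / (x * y)%g}.
Proof.
move=> [[[a s] b]|] [[[c t] d]|];
  rewrite ?[of_brandt None]/(bz_zero F1_set0) ?bz_mul0 ?bz_mulr0 //.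
(* For two nonzero factors, (b - s) + s and (c - t) + t reduce to b and c, so the nonvanishing
   condition becomes the Brandt condition b = c. *)
rewrite [RHS]bz_F1_eltM !subrK [(_ * _)%g]/(brandt_mul _ _) /brandt_mul.
by case: eqP.
Qed.

Theorem mainTheorem12 :
  (exists f : bz_F1 -> brandt int omega_min,
    unique (fun g : bz_F1 -> brandt int omega_min =>
        (forall (i j : int) (k : nat),
            g (bz_F1_elt i j k) = brandt_elt (i + k%:Z) (k : omega_min) (j + k%:Z)) /\
        g (bz_zero F1_set0) = brandt_zero int omega_min) f /\
    semigroup_isomorphism f) /\
  isomorphic bz_F1 (brandt int omega_min).
Proof.
(* A choice of preimages is a right inverse of [of_brandt], and by injectivity a two-sided one. *)
have [f fK] := choice of_brandt_surj.
have Kf : cancel of_brandt f := inj_can_sym fK of_brandt_inj.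
have iso_f : semigroup_isomorphism f.
  split; last by exists of_brandt.
  by move=> x y; apply: of_brandt_inj; rewrite of_brandtM !fK.
split; last by exists f.
exists f; split=> //; split.
  split=> [i j k|]; apply: of_brandt_inj; rewrite fK //.
  by rewrite of_brandt_elt.
(* Uniqueness: the prescribed values cover the zero and all triples, hence every element. *)
move=> g [gE g0]; apply/funext => x; apply: of_brandt_inj; rewrite fK.
have [->|[i [j [k ->]]]] := bz_F1_cases x; first by rewrite g0.
by rewrite gE of_brandt_elt.
Qed.
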